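(* Let $d\ge 2$ and let $$f(d)=\max_{1\le i\le d-1}\{DS^{\ast}_i(2)+LDS_{d-i}(2)\}.$$ If $X$ is a proper locally two-distance set in $\mathbb{R}^d$, then $|X|\le f(d)$. In particular, $$LDS_d(2)\le\max\{DS_d(2),f(d)\}.$$
   Context: $d(x,y)$ is the Euclidean distance. A set $X\subset\mathbb{R}^d$ is a two-distance set if $\{d(x,y):x,y\in X,\ x\ne y\}$ has exactly two elements; it is a locally two-distance set if for every $x\in X$ the set $\{d(x,y):y\in X,\ y\ne x\}$ has at most two elements. A locally two-distance set is proper if it is not a two-distance set. $DS_d(2)$ (resp. $LDS_d(2)$) denotes the largest cardinality of a two-distance set (resp. locally two-distance set) in $\mathbb{R}^d$. $DS^{\ast}_i(2)$ denotes the largest cardinality of a two-distance set contained in the unit sphere $S^{i-1}\subset\mathbb{R}^i$, with the convention $DS^{\ast}_1(2)=2$ (since $S^0$ consists of two points). *)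

(* Defs.v *)
From HB Require Import structures.
From mathcomp Require Import all_boot all_order all_algebra.
From mathcomp Require Import boolp classical_sets functions cardinality reals.

Set Implicit Arguments.
Unset Strict Implicit.
Unset Printing Implicit Defensive.

Import Order.TTheory GRing.Theory Num.Theory.
Local Open Scope classical_set_scope.
Local Open Scope card_scope.
Local Open Scope ring_scope.

(* MathComp-Analysis equips 'rV[R]_d with the sup norm, hence an explicit
   Euclidean norm. *)
Definition enorm (R : realType) (d : nat) (x : 'rV[R]_d) : R :=
  Num.sqrt (\sum_(k < d) x ord0 k ^+ 2).

Definition edist (R : realType) (d : nat) (x y : 'rV[R]_d) : R :=
  enorm (x - y).

Definition unit_sphere (R : realType) (d : nat) : set 'rV[R]_d :=
  [set x | enorm x = 1].
Arguments unit_sphere : clear implicits.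

Definition distances (R : realType) (d : nat) (X : set 'rV[R]_d) : set R :=
  [set r | exists x y, [/\ X x, X y, x <> y & r = edist x y]].

Definition distances_from (R : realType) (d : nat) (X : set 'rV[R]_d)
    (x : 'rV[R]_d) : set R :=
  [set r | exists y, [/\ X y, y <> x & r = edist x y]].

Definition two_distance (R : realType) (d : nat) (X : set 'rV[R]_d) : Prop :=
  distances X #= `I_2.

Definition locally_two_distance (R : realType) (d : nat)
    (X : set 'rV[R]_d) : Prop :=
  forall x, X x -> distances_from X x #<= `I_2.

Definition proper_locally_two_distance (R : realType) (d : nat)
    (X : set 'rV[R]_d) : Prop :=
  locally_two_distance X /\ ~ two_distance X.

Definition is_largest_card (T : Type) (P : set (set T)) (n : nat) : Prop :=
  (exists2 X, P X & X #= `I_n) /\ (forall X, P X -> X #<= `I_n).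

(* The value is the junk 0 when no largest cardinality exists.  This does not
   happen for the families below in the dimensions that matter (d >= 1 for DS
   and LDS, d >= 2 for the spherical family): they are nonempty, and the sizes
   of their members are bounded in terms of d. *)
Definition largest_card (T : Type) (P : set (set T)) : nat :=
  xget 0%N [set n | is_largest_card P n].

Definition DS (R : realType) (d : nat) : nat :=
  largest_card [set X : set 'rV[R]_d | two_distance X].

Definition LDS (R : realType) (d : nat) : nat :=
  largest_card [set X : set 'rV[R]_d | locally_two_distance X].

(* The value at i = 1 is a convention: the two points of S^0 determine only
   one distance, so S^0 contains no two-distance set. *)
Definition DSstar (R : realType) (i : nat) : nat :=
  if i == 1%N then 2%N
  else largest_card
         [set X : set 'rV[R]_i | two_distance X /\ X `<=` unit_sphere R i].

Definition f (R : realType) (d : nat) : nat :=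
  \max_(1 <= i < d) (DSstar R i + LDS R (d - i))%N.

(* Main.v *)
Require Import Defs.
From mathcomp Require Import all_boot all_order all_algebra.
From mathcomp Require Import boolp classical_sets functions cardinality reals.
From mathcomp Require Import finmap ring lra.

(** Write D(x) for the set of at most two distances seen from a point x of the
locally two-distance set X, and sort the points of X into classes according to
the value of D.  If z lies outside the class Y of x, then D(z) and D(x) are
different sets with at most two elements, so they share at most one distance;
as the distance from z to any y in Y lies in both, z is equidistant from all
of Y (distances_from_equidistant).

Such a splitting X = Y + Z forces a splitting of the dimension (split_bound).
For z, z' in Z and y, y' in Y, equidistance says that z - z' is orthogonal to
y - y'.  If the differences of Y span a space of dimension i, then Y fits in
R^i, where it lies on the sphere centred at the projection of any point of Z,
and Z fits in the orthogonal complement R^(d-i).  As the distances inside Y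
belong to D(x), the size of Y is at most DSstar i, while that of Z is at most
LDS (d - i).  Both i and d - i are positive once Y and Z have two points each.

It remains to see that a class with two points and two points in its
complement can be found.
- If X has a single distance, the remaining points lie in the bisecting
  hyperplane of any two of them, so |X| <= 2 + LDS (d - 1) (bisector_bound).
- Otherwise the distances of X do not fit in a two-element set.  A class whose
  complement is at most one point would make every distance of X one that
  is seen from that class, so every complement has at least two points.
- If all classes are singletons, then |X| <= 3 (injective_bound), which is
  again at most 2 + LDS (d - 1).

Two facts make the extremal numbers meaningful.  The sizes of locally
two-distance sets are bounded: all but two points x, y lie in at most four
hyperplanes orthogonal to x - y, according to their distances to x and y
(locally_two_distance_bounded).  A one-distance set on the sphere
of R^i, which is not a competitor in DSstar i, still has at most 2 * i points,
no more than the vertices of the cross-polytope (equidistant_bound,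
leq_DSstar). *)

Set Implicit Arguments.
Unset Strict Implicit.
Unset Printing Implicit Defensive.

Import Order.TTheory GRing.Theory Num.Theory.
Local Open Scope classical_set_scope.
Local Open Scope card_scope.
Local Open Scope ring_scope.

(** * Cardinalities of small sets *)

Lemma card_le_I_seq (T : choiceType) (A : set T) n :
  A #<= `I_n -> exists2 s : seq T, (size s <= n)%N & A = [set` s].
Proof.
move=> An; have finA : finite_set A by apply/finite_set_leP; exists n.
by exists (fset_set A); [exact: geq_card_fset_set|rewrite fset_setK].
Qed.

(** Bounding the length of duplicate-free lists avoids handling infinite sets
separately: an infinite set contains such lists of every length. *)
Lemma card_le_IP (T : choiceType) (A : set T) n :
  A #<= `I_n <->
  (forall s : seq T, uniq s -> [set` s] `<=` A -> (size s <= n)%N).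
Proof.
split=> [/card_le_I_seq[t tn ->] s us st|H].
  by apply: leq_trans tn; apply: uniq_leq_size.
have [finA|infA] := pselect (finite_set A).
  have /finite_setP[m Am] := finA; rewrite (card_le_eql Am) card_le_II.
  rewrite -(card_fset_set Am); apply: H; first exact: fset_uniq.
  by rewrite fset_setK.
have [B BA Bn] := infinite_set_fset n.+1 infA.
by have := leq_trans Bn (H _ (fset_uniq B) BA); rewrite ltnn.
Qed.

Lemma card_le_I1 (T : choiceType) (A : set T) :
  (forall x y, A x -> A y -> x = y) -> A #<= `I_1.
Proof.
move=> H; apply/card_le_IP => -[|x [|y s]] //= /andP[+ _] sA.
have Ax : A x by apply: sA; rewrite /= mem_head.
have Ay : A y by apply: sA; rewrite /= !inE eqxx orbT.
by rewrite (H _ _ Ax Ay) mem_head.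
Qed.

Lemma card_le_I2P (T : choiceType) (A : set T) :
  A #<= `I_2 <->
  (forall p q r, A p -> A q -> A r -> [\/ p = q, p = r | q = r]).
Proof.
split=> [/card_le_IP H p q r Ap Aq Ar|H].
  have [->|pq] := eqVneq p q; first by apply: Or31.
  have [->|pr] := eqVneq p r; first by apply: Or32.
  have [->|qr] := eqVneq q r; first by apply: Or33.
  suff : (size [:: p; q; r] <= 2)%N by [].
  apply: H => [|x /=]; last by rewrite !inE => /or3P[] /eqP->.
  by rewrite /= !inE negb_or pq pr qr.
apply/card_le_IP => -[|p [|q [|r s]]] //= us sA.
have Ap : A p by apply: sA; rewrite /= !inE eqxx.
have Aq : A q by apply: sA; rewrite /= !inE eqxx ?orbT.
have Ar : A r by apply: sA; rewrite /= !inE eqxx ?orbT.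
by case: (H _ _ _ Ap Aq Ar) us => ->; rewrite !inE eqxx ?orbT ?andbF.
Qed.

(** Two-element sets are determined by two of their points; this is what makes
different sets of distances share at most one distance. *)
Lemma card_le_I2_eq (T : choiceType) (A B : set T) p q :
  A #<= `I_2 -> B #<= `I_2 -> p <> q -> A p -> A q -> B p -> B q -> A = B.
Proof.
move=> /card_le_I2P A2 /card_le_I2P B2 pq Ap Aq Bp Bq.
apply/seteqP; split=> r Hr.
  by case: (A2 _ _ _ Ap Aq Hr) => // <-.
by case: (B2 _ _ _ Bp Bq Hr) => // <-.
Qed.

Lemma card_eq_I2 (T : choiceType) (A : set T) p q :
  A #<= `I_2 -> A p -> A q -> p <> q -> A #= `I_2.
Proof.
move=> A2 Ap Aq pq.
have finA : finite_set A by apply/finite_set_leP; exists 2%N.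
have /finite_setP[m Am] := finA.
move: A2; rewrite (card_le_eql Am) card_le_II => m2.
suff : (size [:: p; q] <= m)%N.
  by move=> m2'; have -> : 2%N = m by apply/eqP; rewrite eqn_leq m2 m2'.
have : A #<= `I_m by rewrite (card_le_eql Am) card_lexx.
move=> /card_le_IP; apply; first by rewrite /= inE andbT; apply/eqP.
by move=> x /=; rewrite !inE => /orP[] /eqP->.
Qed.

Lemma card_le_setU (T : choiceType) (A B : set T) m n :
  A #<= `I_m -> B #<= `I_n -> A `|` B #<= `I_(m + n).
Proof.
move=> /card_le_I_seq[s sm ->] /card_le_I_seq[t tn ->].
apply/card_le_IP => u uu ust; apply: leq_trans (leq_add sm tn).
rewrite -size_cat; apply: uniq_leq_size => // x /ust.
by rewrite mem_cat => -[] /= ->; rewrite ?orbT.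
Qed.

(** A uniform bound on the sizes is all that has to be proved for the value of
[largest_card] to be attained and maximal. *)
Lemma is_largest_largest_card (T : Type) (P : set (set T)) N :
  P !=set0 -> (forall X, P X -> X #<= `I_N) ->
  is_largest_card P (largest_card P).
Proof.
move=> [X0 PX0] PN; rewrite /largest_card; apply: xgetPex => /=.
have fin X : P X -> exists2 m, X #= `I_m & (m <= N)%N.
  move=> PX; have /finite_setP[m Xm] : finite_set X.
    by apply/finite_set_leP; exists N; exact: PN.
  by exists m => //; have := PN _ PX; rewrite (card_le_eql Xm) card_le_II.
pose Q n := `[< exists2 X, P X & X #= `I_n >].
have exQ : exists n, Q n.
  by have [m Xm _] := fin _ PX0; exists m; apply/asboolP; exists X0.
have ubQ n : Q n -> (n <= N)%N.
  move=> /asboolP[X PX Xn]; have := PN _ PX.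
  by rewrite (card_le_eql Xn) card_le_II.
case: (ex_maxnP exQ ubQ) => m /asboolP Qm mmax; exists m; split=> // X PX.
have [k Xk _] := fin _ PX; rewrite (card_le_eql Xk) card_le_II.
by apply: mmax; apply/asboolP; exists X.
Qed.

Lemma size_fibres (T U : eqType) (h : T -> U) (vs : seq U) (s : seq T) N :
  (forall z, z \in s -> h z \in vs) ->
  (forall v, (size [seq z <- s | h z == v] <= N)%N) ->
  (size s <= size vs * N)%N.
Proof.
elim: vs s => [|v vs IH] s hs fib /=.
  by case: s hs {fib} => // z s /(_ z (mem_head _ _)).
rewrite -(count_predC (fun z => h z == v)) mulSn -!size_filter.
apply: leq_add => //; apply: IH => [z|w].
  by rewrite mem_filter => /andP[/= /negPf hz /hs]; rewrite inE hz.
rewrite -filter_predI; apply: leq_trans (fib w).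
rewrite !size_filter; apply: sub_count => z /= /andP[//].
Qed.

(** * Scalar product and Euclidean distance *)

Section Geometry.
Variable R : realType.

Definition dot n (u v : 'rV[R]_n) : R := (u *m v^T) 0 0.

Lemma dotE n (u v : 'rV_n) : dot u v = \sum_k u 0 k * v 0 k.
Proof. by rewrite /dot mxE; apply: eq_bigr => k _; rewrite mxE. Qed.

Lemma dotC n (u v : 'rV_n) : dot u v = dot v u.
Proof. by rewrite !dotE; apply: eq_bigr => k _; rewrite mulrC. Qed.

Lemma dotDl n (u v w : 'rV_n) : dot (u + v) w = dot u w + dot v w.
Proof. by rewrite /dot mulmxDl mxE. Qed.

Lemma dotZl n a (u w : 'rV_n) : dot (a *: u) w = a * dot u w.
Proof. by rewrite /dot -scalemxAl mxE. Qed.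

Lemma dotNl n (u w : 'rV_n) : dot (- u) w = - dot u w.
Proof. by rewrite -scaleN1r dotZl mulN1r. Qed.

Lemma dotDr n (u v w : 'rV_n) : dot w (u + v) = dot w u + dot w v.
Proof. by rewrite dotC dotDl !(dotC w). Qed.

Lemma dotZr n a (u w : 'rV_n) : dot w (a *: u) = a * dot w u.
Proof. by rewrite dotC dotZl dotC. Qed.

Lemma dotNr n (u w : 'rV_n) : dot w (- u) = - dot w u.
Proof. by rewrite dotC dotNl dotC. Qed.

Definition dot_bilin := (dotDl, dotDr, dotNl, dotNr, dotZl, dotZr).

Lemma dot_ge0 n (u : 'rV_n) : 0 <= dot u u.
Proof. by rewrite dotE; apply: sumr_ge0 => k _; rewrite -expr2 sqr_ge0. Qed.

Lemma dot_eq0 n (u : 'rV_n) : (dot u u == 0) = (u == 0).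
Proof.
apply/eqP/eqP => [|->]; last by rewrite /dot mul0mx mxE.
rewrite dotE => /psumr_eq0P H; apply/rowP => k; rewrite mxE.
apply/eqP; rewrite -sqrf_eq0 expr2; apply/eqP; apply: H => // i _.
by rewrite -expr2 sqr_ge0.
Qed.

Lemma enormE n (u : 'rV[R]_n) : enorm u = Num.sqrt (dot u u).
Proof. by rewrite /enorm dotE. Qed.

(** Equality of distances is used through their squares, which expand
bilinearly. *)
Definition sqdist n (x y : 'rV[R]_n) := dot (x - y) (x - y).

Lemma edistE n (x y : 'rV[R]_n) : edist x y = Num.sqrt (sqdist x y).
Proof. exact: enormE. Qed.

Lemma edist_eq n m (x y : 'rV[R]_n) (z w : 'rV[R]_m) :
  edist x y = edist z w <-> sqdist x y = sqdist z w.
Proof.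
rewrite !edistE; split=> [/eqP|->//].
by rewrite eqr_sqrt ?dot_ge0 // => /eqP.
Qed.

Lemma sqdistC n (x y : 'rV[R]_n) : sqdist x y = sqdist y x.
Proof. by rewrite /sqdist !dot_bilin; ring. Qed.

Lemma edistC n (x y : 'rV[R]_n) : edist x y = edist y x.
Proof. by apply/edist_eq; exact: sqdistC. Qed.

Lemma sqdist_eq0 n (x y : 'rV[R]_n) : sqdist x y = 0 <-> x = y.
Proof.
split=> [/eqP|->]; first by rewrite dot_eq0 subr_eq0 => /eqP.
by apply/eqP; rewrite dot_eq0 subrr.
Qed.

(** * Isometric coordinates on subspaces *)

Lemma isometry_inj n m (Z : set 'rV[R]_n) (g : 'rV[R]_n -> 'rV[R]_m) :
  (forall z w, Z z -> Z w -> edist (g z) (g w) = edist z w) ->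
  {in Z &, injective g}.
Proof.
move=> giso z w /set_mem Zz /set_mem Zw e; apply/sqdist_eq0.
by have /edist_eq <- := giso _ _ Zz Zw; rewrite e; apply/sqdist_eq0.
Qed.

(** Gram-Schmidt: normalise a nonzero row e of A and recurse on the projection
of A to the orthogonal of e, whose rank is one less.  That the rows of B stay
in A is what keeps them orthogonal to e during the recursion. *)
Lemma orthonormal_basis m n r (A : 'M[R]_(m, n)) : \rank A = r ->
  exists B : 'M[R]_(r, n), [/\ B *m B^T = 1%:M, (A <= B)%MS & (B <= A)%MS].
Proof.
elim: r m A => [|r IH] m A rA.
  have A0 : A = 0 by apply/eqP; rewrite -mxrank_eq0 rA.
  by exists 0; rewrite A0 !sub0mx; split=> //; rewrite [LHS]flatmx0 [RHS]flatmx0.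
have [i u0] : exists i, row i A != 0.
  apply: contrapT => H; have A0 : A = 0.
    apply/row_matrixP => i; rewrite row0; apply: contrapT => /eqP Ai.
    by apply: H; exists i.
  by move: rA; rewrite A0 mxrank0.
set u := row i A in u0.
pose e := (Num.sqrt (dot u u))^-1 *: u.
have uu_gt0 : 0 < dot u u by rewrite lt_neqAle eq_sym dot_eq0 u0 dot_ge0.
have ee : e *m e^T = 1%:M.
  rewrite [LHS]mx11_scalar -/(dot e e) !dot_bilin mulrA -expr2 exprVn.
  by rewrite sqr_sqrtr ?dot_ge0 // mulVf ?gt_eqF.
have eA : (e <= A)%MS by rewrite scalemx_sub ?row_sub.
pose A' := A - A *m e^T *m e.
have A'A : (A' <= A)%MS.
  by rewrite addmx_sub // eqmx_opp (submx_trans (submxMl _ _)).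
have A'e : A' *m e^T = 0 by rewrite mulmxBl -!mulmxA ee mulmx1 subrr.
have AeA' : (A <= e + A')%MS.
  have {1}-> : A = A *m e^T *m e + A' by rewrite addrC subrK.
  by apply: addmx_sub_adds; rewrite ?submxMl.
have rA' : \rank A' = r.
  apply/eqP; rewrite eqn_leq -ltnS -rA; apply/andP; split; last first.
    rewrite -ltnS -rA; apply: leq_trans (mxrankS AeA') _.
    apply: leq_trans (mxrank_adds_leqif _ _) _.
    exact: (leq_add (rank_leq_row e) (leqnn _)).
  rewrite -/(\rank A' < \rank A)%N; apply: rank_ltmx.
  rewrite ltmxE A'A; apply/negP => /(submx_trans eA)/submxP[w ew].
  have := ee; rewrite {1}ew -mulmxA A'e mulmx0 => /matrixP/(_ 0 0)/eqP.
  by rewrite !mxE eqxx eq_sym oner_eq0.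
have [B [BB A'B BA']] := IH _ _ rA'.
have Be : B *m e^T = 0.
  by have /submxP[w ->] := BA'; rewrite -mulmxA A'e mulmx0.
have eB : e *m B^T = 0 by rewrite -[LHS]trmxK trmx_mul trmxK Be trmx0.
have onb : col_mx e B *m (col_mx e B)^T = 1%:M.
  by rewrite tr_col_mx mul_col_row ee BB Be eB -scalar_mx_block.
have eBA : (col_mx e B <= A)%MS by rewrite col_mx_sub eA (submx_trans BA').
have AeB : (A <= e + B)%MS by rewrite (submx_trans AeA') // addsmxS.
by rewrite addsmxE in AeB; exists (col_mx e B); split.
Qed.

(** Only v needs to lie in A: the matrix G acts as the orthogonal projection onto
A followed by coordinates, so the scalar product with v does not see the
component of w that is lost.  This locates the centre of the sphere in
[split_bound]. *)
Lemma orthogonal_coords m n r (A : 'M[R]_(m, n)) : \rank A = r ->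
  exists G : 'M[R]_(n, r),
    forall v w : 'rV_n, (v <= A)%MS -> dot (v *m G) (w *m G) = dot v w.
Proof.
move=> /orthonormal_basis[B [BB AB _]]; exists B^T => v w vA.
have /submxP[c ->] := submx_trans vA AB.
by rewrite -(mulmxA c) BB mulmx1 /dot trmx_mul trmxK mulmxA.
Qed.

Lemma isometric_coords m n r (A : 'M[R]_(m, n)) (Z : set 'rV[R]_n) :
  \rank A = r -> (forall z w, Z z -> Z w -> (z - w <= A)%MS) ->
  exists g : 'rV[R]_n -> 'rV[R]_r,
    forall z w, Z z -> Z w -> edist (g z) (g w) = edist z w.
Proof.
move=> /orthogonal_coords[G HG] ZA; exists (fun z => z *m G) => z w Zz Zw.
by apply/edist_eq; rewrite /sqdist -mulmxBl HG //; apply: ZA.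
Qed.

Lemma rank_hyperplane n (u : 'rV[R]_n.+1) : u != 0 -> \rank (kermx u^T) = n.
Proof. by move=> u0; rewrite mxrank_ker mxrank_tr rank_rV u0 subn1. Qed.

Lemma sub_hyperplane n (u v : 'rV[R]_n) : (v <= kermx u^T)%MS = (dot v u == 0).
Proof.
apply/sub_kermxP/eqP => [|H]; first by rewrite /dot => ->; rewrite mxE.
rewrite [LHS]mx11_scalar -/(dot v u) H.
by apply/matrixP => i j; rewrite !mxE mul0rn.
Qed.

Lemma hyperplane_coords n (u : 'rV[R]_n.+1) (Z : set 'rV[R]_n.+1) :
  u != 0 -> (forall z w, Z z -> Z w -> dot (z - w) u = 0) ->
  exists g : 'rV[R]_n.+1 -> 'rV[R]_n,
    forall z w, Z z -> Z w -> edist (g z) (g w) = edist z w.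
Proof.
move=> u0 Zu; apply: (isometric_coords (rank_hyperplane u0)) => z w Zz Zw.
by rewrite sub_hyperplane Zu.
Qed.

(** The loci where the difference of squared distances to x and y is constant
are the hyperplanes orthogonal to x - y. *)
Lemma dot_bisector n (x y z w : 'rV[R]_n) :
  sqdist x z - sqdist y z = sqdist x w - sqdist y w -> dot (z - w) (x - y) = 0.
Proof.
rewrite /sqdist !dot_bilin (dotC z x) (dotC z y) (dotC w x) (dotC w y); lra.
Qed.

(** * Boundedness of the families *)

Lemma locally_two_distance_sub n (X Y : set 'rV[R]_n) :
  Y `<=` X -> locally_two_distance X -> locally_two_distance Y.
Proof.
move=> YX X2 x Yx; apply: card_le_trans (X2 _ (YX _ Yx)).
by apply: subset_card_le => r [y [Yy yx ->]]; exists y; split=> //; apply: YX.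
Qed.

Lemma locally_two_distance_isometry n m (Z : set 'rV[R]_n)
    (g : 'rV[R]_n -> 'rV[R]_m) :
  (forall z w, Z z -> Z w -> edist (g z) (g w) = edist z w) ->
  locally_two_distance Z -> locally_two_distance (g @` Z).
Proof.
move=> giso Z2 _ [x Zx <-]; apply: card_le_trans (Z2 _ Zx).
apply: subset_card_le => r [_ [[y Zy <-] yx ->]]; exists y; split=> //.
- by move=> e; apply: yx; rewrite e.
- exact: giso.
Qed.

Lemma card_isometry n m (Z : set 'rV[R]_n) (g : 'rV[R]_n -> 'rV[R]_m) k :
  (forall z w, Z z -> Z w -> edist (g z) (g w) = edist z w) ->
  g @` Z #<= `I_k -> Z #<= `I_k.
Proof.
move=> /isometry_inj ginj.
by rewrite (card_le_eql (inj_card_eq ginj)).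
Qed.

Lemma distances_isometry n m (Z : set 'rV[R]_n) (g : 'rV[R]_n -> 'rV[R]_m) :
  (forall z w, Z z -> Z w -> edist (g z) (g w) = edist z w) ->
  distances (g @` Z) `<=` distances Z.
Proof.
move=> giso _ [_ [_ [[x Zx <-] [y Zy <-] xy ->]]]; exists x, y; split=> //.
- by move=> e; apply: xy; rewrite e.
- exact: giso.
Qed.

(** Fix two points x and y.  Any other point has one of two distances to x and
one of two distances to y, and the points with both distances prescribed lie
in a hyperplane orthogonal to x - y, where induction applies. *)
Lemma locally_two_distance_bounded n :
  exists N, forall X : set 'rV[R]_n, locally_two_distance X -> X #<= `I_N.
Proof.
elim: n => [|n [N IH]].
  by exists 1%N => X _; apply: card_le_I1 => x y _ _; rewrite [x]thinmx0 [y]thinmx0.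
exists (2 + 4 * N)%N => X X2; apply/card_le_IP => -[|x [|y s]] //.
move=> /andP[xN /= /andP[yN us]] sX.
have [Xx Xy] : X x /\ X y by split; apply: sX; rewrite /= !inE eqxx ?orbT.
have xy : x != y by apply: contraNneq xN => ->; rewrite mem_head.
have [a sa Da] := card_le_I_seq (X2 _ Xx).
have [b sb Db] := card_le_I_seq (X2 _ Xy).
rewrite !ltnS; pose h z := (edist x z, edist y z).
have hs z : z \in s -> h z \in [seq (p, q) | p <- a, q <- b].
  move=> zs; have Xz : X z by apply: sX; rewrite /= !inE zs !orbT.
  apply/allpairsP; exists (h z); split=> //=.
    have : [set` a] (edist x z) by rewrite -Da; exists z; split=> // zx;
      move: xN; rewrite -zx inE zs orbT.
    by [].
  have : [set` b] (edist y z) by rewrite -Db; exists z; split=> // zy;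
    move: yN; rewrite -zy zs.
  by [].
have := size_fibres hs; rewrite size_allpairs => /(_ N) H.
apply: leq_trans (H _) _; last by rewrite leq_mul2r (leq_mul sa sb) orbT.
move=> v; pose Z := [set z | X z /\ h z = v].
suff /card_le_IP : Z #<= `I_N.
  apply; first exact: filter_uniq.
  move=> z; rewrite /= mem_filter => /andP[/eqP hz zs]; split=> //.
  by apply: sX; rewrite /= !inE zs !orbT.
have [|z w [Xz hz] [Xw hw]|g giso] := @hyperplane_coords _ (x - y) Z.
- by rewrite subr_eq0.
- have [/edist_eq e1 /edist_eq e2] : h z = h w by rewrite hz hw.
  by apply: dot_bisector; rewrite e1 e2.
apply: (card_isometry giso); apply: IH; apply: (locally_two_distance_isometry giso).
by apply: locally_two_distance_sub X2 => z [].
Qed.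

Lemma is_largest_LDS n :
  is_largest_card [set X : set 'rV[R]_n | locally_two_distance X] (LDS R n).
Proof.
have [N /is_largest_largest_card] := locally_two_distance_bounded n.
by apply; exists set0.
Qed.

Lemma LDS_max n (X : set 'rV[R]_n) :
  locally_two_distance X -> X #<= `I_(LDS R n).
Proof. by have [_] := is_largest_LDS n; apply. Qed.

Lemma two_distance_locally n (X : set 'rV[R]_n) :
  distances X #<= `I_2 -> locally_two_distance X.
Proof.
move=> X2 x Xx; apply: card_le_trans X2; apply: subset_card_le.
by move=> r [y [Xy yx ->]]; exists x, y; split=> // /esym.
Qed.

Lemma DS_max n (X : set 'rV[R]_n) : two_distance X -> X #<= `I_(DS R n).
Proof.
have [N HN] := locally_two_distance_bounded n => X2.
have [||_ H] := @is_largest_largest_card _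
  [set X : set 'rV[R]_n | two_distance X] N; last exact: H.
  by exists X.
move=> Y Y2; apply/HN/two_distance_locally.
by rewrite (card_le_eql Y2) card_lexx.
Qed.

Lemma LDS_ge1 n : (1 <= LDS R n)%N.
Proof.
have : [set 0 : 'rV[R]_n] #<= `I_(LDS R n).
  apply: LDS_max => x /= -> /=.
  by apply/card_le_I2P => p q r [y [-> []]].
by rewrite (card_le_eql card_set1) card_le_II.
Qed.

(** Each of the other points is equidistant from any two given ones, hence lies
in their bisecting hyperplane: one dimension costs two points.  The true bound
is one more than the dimension; the weaker one suffices because it matches the
size of the cross-polytope. *)
Lemma equidistant_bound n (X : set 'rV[R]_n.+1) :
  (forall p q, distances X p -> distances X q -> p = q) ->
  X #<= `I_(2 * n.+1).
Proof.
have mkd m (Y : set 'rV[R]_m) u v : Y u -> Y v -> u != v -> distances Y (edist u v).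
  by move=> Yu Yv uv; exists u, v; split=> //; apply/eqP.
elim: n X => [|n IH] X X1; apply/card_le_IP => -[|x [|y s]] //.
  case: s => // z s /=; rewrite !inE !negb_or => /andP[/andP[xy /andP[xz _]]].
  move=> /andP[/andP[yz _] _] sX.
  have Xx : X x by apply: sX; rewrite /= !inE eqxx ?orbT.
  have Xy : X y by apply: sX; rewrite /= !inE eqxx ?orbT.
  have Xz : X z by apply: sX; rewrite /= !inE eqxx ?orbT.
  have /edist_eq e1 := X1 _ _ (mkd _ _ _ _ Xx Xy xy) (mkd _ _ _ _ Xx Xz xz).
  have /edist_eq e2 := X1 _ _ (mkd _ _ _ _ Xx Xy xy) (mkd _ _ _ _ Xy Xz yz).
  have row1 (u v : 'rV[R]_1) : u 0 0 = v 0 0 -> u = v.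
    by move=> e; apply/rowP => i; rewrite ord1.
  have neq0 (u v : 'rV[R]_1) : u != v -> u 0 0 - v 0 0 != 0.
    by apply: contra_neq => /eqP; rewrite subr_eq0 => /eqP /row1.
  move: e1 e2; rewrite /sqdist !dotE !big_ord1 !mxE => e1 e2.
  (* On the line, each of x and y would be the midpoint of the two others. *)
  have f1 : y 0 0 + z 0 0 = 2 * x 0 0.
    by apply: (mulfI (neq0 _ _ yz)); lra.
  have f2 : x 0 0 + z 0 0 = 2 * y 0 0.
    by apply: (mulfI (neq0 _ _ xz)); lra.
  have f3 : x 0 0 - y 0 0 = 0 by lra.
  by have := neq0 _ _ xy; rewrite f3 eqxx.
move=> /= /andP[]; rewrite inE negb_or => /andP[xy xs] /andP[ys us] sX.
have Xx : X x by apply: sX; rewrite /= !inE eqxx ?orbT.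
have Xy : X y by apply: sX; rewrite /= !inE eqxx ?orbT.
rewrite mulnS !addSn add0n !ltnS.
have sne z : z \in s -> [/\ X z, x != z & y != z].
  move=> zs; split; first by apply: sX; rewrite /= !inE zs !orbT.
    by apply: contraNneq xs => ->.
  by apply: contraNneq ys => ->.
pose Z := [set` s].
have [|z w /= zs ws|g giso] := @hyperplane_coords _ (x - y) Z.
- by rewrite subr_eq0.
- have [Xz xz yz] := sne z zs; have [Xw xw yw] := sne w ws.
  have /edist_eq e1 := X1 _ _ (mkd _ _ _ _ Xx Xz xz) (mkd _ _ _ _ Xy Xz yz).
  have /edist_eq e2 := X1 _ _ (mkd _ _ _ _ Xx Xw xw) (mkd _ _ _ _ Xy Xw yw).
  by apply: dot_bisector; rewrite e1 e2 !subrr.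
have ZX : Z `<=` X by move=> z /= zs; have [] := sne z zs.
suff /card_le_IP : Z #<= `I_(2 * n.+1) by apply.
apply: (card_isometry giso); apply: IH => p q.
move=> /(distances_isometry giso) [a [b [Za Zb ab ->]]].
move=> /(distances_isometry giso) [c [d [Zc Zd cd ->]]].
by apply: X1; [exists a, b | exists c, d]; split=> //; apply: ZX.
Qed.

(** * Spherical two-distance sets *)

Definition cross_vertex n (a : 'I_n * bool) : 'rV[R]_n :=
  (-1) ^+ a.2 *: delta_mx 0 a.1.

Definition cross_polytope n : set 'rV[R]_n := range (@cross_vertex n).

Lemma dot_cross_vertex n (a b : 'I_n * bool) :
  dot (cross_vertex a) (cross_vertex b) =
  if a.1 == b.1 then if a.2 == b.2 then 1 else - 1 else 0 :> R.
Proof.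
rewrite !dot_bilin dotE (bigD1 a.1) //= big1 => [|k ka]; last first.
  by rewrite !mxE (negPf ka) andbF mul0r.
rewrite addr0 !mxE !eqxx /= mul1r.
case: eqP => _; last by rewrite !mulr0.
by case: a.2 b.2 => [] []; rewrite /= ?expr0 ?expr1; ring.
Qed.

Lemma sqdist_cross_vertex n (a b : 'I_n * bool) : a != b ->
  sqdist (cross_vertex a) (cross_vertex b) =
  if a.1 == b.1 then 4%:R else 2%:R :> R.
Proof.
move=> ab; rewrite /sqdist dotDl !dotDr !dotNl !dotNr !dot_cross_vertex !eqxx.
rewrite (eq_sym b.1) (eq_sym b.2); case: eqP => [e|_]; last by ring.
case: eqP => [e2|_]; last by ring.
by move: ab; rewrite [a]surjective_pairing [b]surjective_pairing e e2 eqxx.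
Qed.

Lemma cross_vertex_inj n : injective (@cross_vertex n).
Proof.
move=> a b e; apply: contrapT => /eqP /sqdist_cross_vertex.
have -> : sqdist (cross_vertex a) (cross_vertex b) = 0 by apply/sqdist_eq0.
by case: ifP => _ /eqP; rewrite eq_sym pnatr_eq0.
Qed.

Lemma cross_polytope_sphere n : @cross_polytope n `<=` unit_sphere R n.
Proof.
by move=> _ [a _ <-]; rewrite /unit_sphere /= enormE dot_cross_vertex !eqxx sqrtr1.
Qed.

Lemma cross_polytope_two_distance n :
  (2 <= n)%N -> two_distance (@cross_polytope n).
Proof.
move=> n2.
have n0 : (0 < n)%N by apply: leq_trans n2.
pose i : 'I_n := Ordinal n0; pose j : 'I_n := Ordinal n2.
apply: (@card_eq_I2 _ _ (Num.sqrt 4%:R) (Num.sqrt 2%:R)).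
- have D r : distances (@cross_polytope n) r ->
      r = Num.sqrt 4%:R \/ r = Num.sqrt 2%:R.
    move=> [_ [_ [[a _ <-] [b _ <-] ab ->]]].
    have ab' : a != b by apply: contra_notN ab => /eqP ->.
    by rewrite edistE sqdist_cross_vertex //; case: ifP; [left|right].
  apply/card_le_I2P => p q r.
  by move=> /D[] -> /D[] -> /D[] ->; 
    first [by apply: Or31|by apply: Or32|by apply: Or33].
- exists (cross_vertex (i, true)), (cross_vertex (i, false)); split.
  + by exists (i, true).
  + by exists (i, false).
  + by move/cross_vertex_inj.
  + by rewrite edistE sqdist_cross_vertex //= eqxx.
- exists (cross_vertex (i, true)), (cross_vertex (j, true)); split.
  + by exists (i, true).
  + by exists (j, true).
  + by move/cross_vertex_inj.
  + by rewrite edistE sqdist_cross_vertex.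
- by move=> /eqP; rewrite eqr_sqrt ?ler0n // eqr_nat.
Qed.

Lemma card_cross_polytope n m : @cross_polytope n #<= `I_m -> (2 * n <= m)%N.
Proof.
move=> /card_le_IP /(_ [seq cross_vertex a | a <- enum {: 'I_n * bool}]).
rewrite size_map -cardE card_prod card_ord card_bool mulnC; apply.
  by rewrite map_inj_uniq ?enum_uniq //; exact: cross_vertex_inj.
by move=> _ /= /mapP[a _ ->]; exists a.
Qed.

Lemma DSstar_max n (X : set 'rV[R]_n) : (2 <= n)%N ->
  two_distance X -> X `<=` unit_sphere R n -> X #<= `I_(DSstar R n).
Proof.
move=> n2 X2 XS; have [N HN] := locally_two_distance_bounded n.
rewrite /DSstar gtn_eqF //.
have [||_ H] := @is_largest_largest_card _
  [set X : set 'rV[R]_n | two_distance X /\ X `<=` unit_sphere R n] N; last 1 first.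
- exact: H.
- by exists X.
- move=> Y [Y2 _]; apply/HN/two_distance_locally.
  by rewrite (card_le_eql Y2) card_lexx.
Qed.

Lemma leq_DSstar n : (0 < n)%N -> (2 * n <= DSstar R n)%N.
Proof.
case: n => [|[|n]] // _; apply: card_cross_polytope; apply: DSstar_max => //.
  exact: cross_polytope_two_distance.
exact: cross_polytope_sphere.
Qed.

(** A set with at most two distances either has exactly two, and competes in
[DSstar], or is equidistant and no larger than the cross-polytope.  The sphere
S^0 is treated by hand. *)
Lemma unit_sphere_bound n (Y : set 'rV[R]_n) : (0 < n)%N ->
  Y `<=` unit_sphere R n -> distances Y #<= `I_2 -> Y #<= `I_(DSstar R n).
Proof.
case: n Y => [|[|n]] // Y _ YS Y2.
  apply/card_le_I2P => p q r Yp Yq Yr.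
  have pm (u : 'rV[R]_1) : Y u -> u = const_mx 1 \/ u = const_mx (- 1).
    move=> /YS; rewrite /unit_sphere /= enormE => u1.
    have : dot u u = 1.
      by rewrite -[LHS]sqr_sqrtr ?dot_ge0 // u1 expr1n.
    rewrite dotE big_ord1 -expr2 => /eqP; rewrite sqrf_eq1 => /orP[]/eqP uE.
      by left; apply/rowP => i; rewrite ord1 uE mxE.
    by right; apply/rowP => i; rewrite ord1 uE mxE.
  by case: (pm _ Yp) (pm _ Yq) (pm _ Yr) => -> [] -> [] ->;
    
    first [by apply: Or31|by apply: Or32|by apply: Or33].
have [Yeq|Yneq] := pselect (two_distance Y); first exact: DSstar_max.
have : Y #<= `I_(2 * n.+2).
  apply: equidistant_bound => p q Dp Dq; apply: contrapT => pq.
  exact: Yneq (card_eq_I2 Y2 Dp Dq pq).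
move=> /card_le_trans; apply; rewrite card_le_II; exact: leq_DSstar.
Qed.

(** Two distinct points ensure that the radius is nonzero, so that the sphere can
be rescaled to the unit one. *)
Lemma sphere_bound n (Y : set 'rV[R]_n) c k y1 y2 :
  (0 < n)%N -> (forall y, Y y -> sqdist y c = k) -> Y y1 -> Y y2 -> y1 <> y2 ->
  distances Y #<= `I_2 -> Y #<= `I_(DSstar R n).
Proof.
move=> n0 Yk Yy1 Yy2 y12 Y2.
have k0 : 0 < k.
  rewrite lt_neqAle -{2}(Yk _ Yy1) dot_ge0 andbT eq_sym.
  apply/eqP => k0; apply: y12.
  by transitivity c; [|symmetry]; apply/sqdist_eq0; rewrite Yk.
pose a := (Num.sqrt k)^-1.
have a0 : 0 < a by rewrite invr_gt0 sqrtr_gt0.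
have a2 : a ^+ 2 = k^-1 by rewrite exprVn sqr_sqrtr // ltW.
pose h (y : 'rV[R]_n) := a *: (y - c).
have hiso y z : edist (h y) (h z) = a * edist y z.
  rewrite !edistE /sqdist -scalerBr opprB addrA subrK dotZl dotZr mulrA -expr2.
  by rewrite sqrtrM ?sqr_ge0 // sqrtr_sqr gtr0_norm.
have hinj : injective h.
  by move=> y z /(scalerI (lt0r_neq0 a0)) /addIr.
rewrite -(card_le_eql (inj_card_eq (in2W hinj))).
apply: unit_sphere_bound => //.
  move=> _ [y Yy <-]; rewrite /unit_sphere /= enormE dotZl dotZr mulrA -expr2 a2.
  by rewrite -/(sqdist y c) Yk // mulVf ?gt_eqF // sqrtr1.
apply: card_le_trans Y2; apply: card_le_trans (card_image_le ( *%R a) _).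
apply: subset_card_le => _ [_ [_ [[y Yy <-] [z Yz <-] yz ->]]].
exists (edist y z); last by rewrite hiso.
by exists y, z; split=> // e; apply: yz; rewrite e.
Qed.

(** * Splitting along orthogonal subspaces *)

(** Every point of Z being equidistant from Y, the differences of Z are orthogonal
to those of Y.  A subspace A of least dimension containing the differences of Y
therefore lies in the orthogonal of each difference of Z: otherwise cutting A
by that hyperplane would give a smaller one. *)
Lemma split_bound d (Y Z : set 'rV[R]_d) y1 y2 z1 z2 :
  Y y1 -> Y y2 -> y1 <> y2 -> Z z1 -> Z z2 -> z1 <> z2 ->
  distances Y #<= `I_2 -> locally_two_distance Z ->
  (forall z y y', Z z -> Y y -> Y y' -> edist y z = edist y' z) ->
  exists i,
    [/\ (1 <= i < d)%N, Y #<= `I_(DSstar R i) & Z #<= `I_(LDS R (d - i))].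
Proof.
move=> Yy1 Yy2 y12 Zz1 Zz2 z12 Y2 Z2 YZ.
pose spans r := `[< exists A : 'M[R]_d,
  \rank A = r /\ forall y, Y y -> (y - y1 <= A)%MS >].
have exr : exists r, spans r.
  exists d; apply/asboolP; exists 1%:M.
  by rewrite mxrank1; split=> // *; exact: submx1.
case: (ex_minnP exr) => r /asboolP[A [rA YA]] rmin.
have ZA z : Z z -> (z - z1 <= kermx A^T)%MS.
  move=> Zz; suff AK : (A <= kermx (z - z1)^T)%MS.
    apply/sub_kermxP; move/sub_kermxP: AK => AK.
    by rewrite -[LHS]trmxK trmx_mul trmxK AK trmx0.
  have AC : (A <= A :&: kermx (z - z1)^T)%MS.
    rewrite -(geq_leqif (mxrank_leqif_sup (capmxSl _ _))) rA; apply: rmin.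
    apply/asboolP; exists (A :&: kermx (z - z1)^T)%MS; split=> // y Yy.
    rewrite sub_capmx YA //= sub_hyperplane.
    have /edist_eq e := YZ _ _ _ Zz Yy Yy1.
    have /edist_eq e' := YZ _ _ _ Zz1 Yy Yy1.
    by rewrite dotC dot_bisector // e e' !(sqdistC _ z) !(sqdistC _ z1) ?subrr.
  by apply: submx_trans AC (capmxSr _ _).
have rK : \rank (kermx A^T) = (d - r)%N by rewrite mxrank_ker mxrank_tr rA.
have r0 : (0 < r)%N.
  rewrite lt0n -rA mxrank_eq0; apply/eqP => A0; apply: y12.
  by have := YA _ Yy2; rewrite A0 submx0 subr_eq0 => /eqP.
have rd : (r < d)%N.
  rewrite -subn_gt0 -rK lt0n mxrank_eq0; apply/eqP => K0; apply: z12.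
  by have := ZA _ Zz2; rewrite K0 submx0 subr_eq0 => /eqP.
exists r; split; first by rewrite r0.
  have [G HG] := orthogonal_coords rA.
  pose g y := (y - y1) *m G.
  have Yd y y' : Y y -> Y y' -> (y - y' <= A)%MS.
    move=> Yy Yy'.
    have -> : y - y' = (y - y1) - (y' - y1) by rewrite opprB addrA subrK.
    by rewrite addmx_sub ?eqmx_opp ?YA.
  have giso y y' : Y y -> Y y' -> edist (g y) (g y') = edist y y'.
    move=> Yy Yy'; apply/edist_eq; rewrite /sqdist -mulmxBl opprB addrA subrK.
    by rewrite HG ?Yd.
  apply: (card_isometry giso).
  (* As g y1 = 0, the radius of the sphere is the norm of g z1. *)
  apply: (@sphere_bound _ _ (g z1) (dot (g z1) (g z1)) (g y1) (g y2)) => //.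
  - move=> _ [y Yy <-]; have /edist_eq := YZ _ _ _ Zz1 Yy Yy1.
    have e1 := HG (y - y1) (y - y1) (YA _ Yy).
    have e2 := HG (y - y1) (z1 - y1) (YA _ Yy).
    have -> : sqdist (g y) (g z1) =
      dot (g y) (g y) - 2 * dot (g y) (g z1) + dot (g z1) (g z1).
      by rewrite /sqdist !dot_bilin (dotC (g z1) (g y)); ring.
    rewrite e1 e2 /sqdist !dot_bilin (dotC z1 y) (dotC y1 y) (dotC z1 y1); lra.
  - move=> e; apply: y12; apply: (isometry_inj giso) => //; exact: mem_set.
  - apply: card_le_trans Y2; apply: subset_card_le; exact: distances_isometry.
have [|g giso] := isometric_coords (Z := Z) rK.
  move=> z z' Zz Zz'.
  have -> : z - z' = (z - z1) - (z' - z1) by rewrite opprB addrA subrK.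
  by rewrite addmx_sub ?eqmx_opp ?ZA.
apply: (card_isometry giso); apply: LDS_max; exact: locally_two_distance_isometry.
Qed.

(** * Classes of points seeing the same distances *)

Lemma leq_f d i : (1 <= i < d)%N -> (DSstar R i + LDS R (d - i) <= f R d)%N.
Proof.
by move=> id; apply: (@leq_bigmax_seq _ _ xpredT); rewrite ?mem_index_iota.
Qed.

Lemma leq_f1 n : (0 < n)%N -> (2 + LDS R n <= f R n.+1)%N.
Proof.
by move=> n0; have := @leq_f n.+1 1%N; rewrite subn1; apply; rewrite ltnS.
Qed.

(** Here no sphere is involved: this is the splitting with i = 1, where Z may
also be empty or a single point. *)
Lemma bisector_bound n (X : set 'rV[R]_n.+1) x y :
  locally_two_distance X -> X x -> X y -> x <> y ->
  (forall z, X z -> z <> x -> z <> y -> edist x z = edist y z) ->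
  X #<= `I_(2 + LDS R n).
Proof.
move=> X2 Xx Xy xy Xeq; pose Z := X `\` [set x; y].
have XE : X `<=` [set x; y] `|` Z.
  move=> z Xz; have [zxy|zxy] := pselect ([set x; y] z); first by left.
  by right; split.
apply: card_le_trans (subset_card_le XE) _; apply: card_le_setU.
  apply/card_le_I2P => p q r [->|->] [->|->] [->|->];
    first [by apply: Or31|by apply: Or32|by apply: Or33].
have Zeq z : Z z -> edist x z = edist y z.
  by move=> [Xz zxy]; apply: Xeq => // e; apply: zxy; [left|right].
have [||g giso] := @hyperplane_coords _ (x - y) Z.
- by rewrite subr_eq0; apply/eqP.
- move=> z w /Zeq/edist_eq ez /Zeq/edist_eq ew.
  by apply: dot_bisector; rewrite ez ew !subrr.
apply: (card_isometry giso); apply: LDS_max.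
apply: (locally_two_distance_isometry giso).
by apply: locally_two_distance_sub X2 => z [].
Qed.

Section Classes.
Variables (d : nat) (X : set 'rV[R]_d).
Hypothesis X2 : locally_two_distance X.

Lemma distances_from_l x y : X y -> x <> y -> distances_from X x (edist x y).
Proof. by move=> Xy xy; exists y; split=> // /esym. Qed.

Lemma distances_from_r x y : X x -> x <> y -> distances_from X y (edist x y).
Proof. by move=> Xx xy; exists x; split=> //; rewrite edistC. Qed.

(** Two different values of the distance from z to the class of x would both
belong to the sets of distances seen from z and from x, making these equal. *)
Lemma distances_from_equidistant x y y' z :
  X x -> X y -> X y' -> X z ->
  distances_from X y = distances_from X x ->
  distances_from X y' = distances_from X x ->
  distances_from X z <> distances_from X x -> edist y z = edist y' z.
Proof.
move=> Xx Xy Xy' Xz Dy Dy' Dz; apply: contrapT => yz; apply: (Dz).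
have zy : y <> z by move=> e; apply: Dz; rewrite -e.
have zy' : y' <> z by move=> e; apply: Dz; rewrite -e.
apply: card_le_I2_eq (X2 Xz) (X2 Xx) yz _ _ _ _.
- exact: distances_from_r.
- exact: distances_from_r.
- by rewrite -Dy; exact: distances_from_l.
- by rewrite -Dy'; exact: distances_from_l.
Qed.

Hypothesis inj :
  forall x y, X x -> X y -> distances_from X x = distances_from X y -> x = y.

(** If a is seen from everywhere, a further distance b between z and z' forces both
to see exactly a and b, against injectivity; so every point sees a only, against
injectivity again. *)
Lemma no_common_distance a x y :
  X x -> X y -> x <> y -> (forall z, X z -> distances_from X z a) -> False.
Proof.
move=> Xx Xy xy Xa; apply: xy.
have Da z : X z -> distances_from X z = [set a].
  move=> Xz; apply/seteqP; split=> [b Db|_ ->]; last exact: Xa.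
  apply: contrapT => /eqP; rewrite eq_sym => /eqP ab.
  have [z' [Xz' zz' bE]] := Db.
  have Db' : distances_from X z' b.
    by rewrite bE; apply: distances_from_r => // /esym.
  apply: zz'; apply: inj => //.
  by apply: card_le_I2_eq (X2 Xz') (X2 Xz) ab _ _ _ _ => //; exact: Xa.
by apply: inj; rewrite ?Da.
Qed.

(** The distances from a point w not seeing a to x, y and z are all different
from a, and two of them are equal; the two points concerned then see the same
pair of distances. *)
Lemma distance_spreads a x y z w :
  X x -> X y -> X z -> X w -> x <> y -> x <> z -> y <> z ->
  distances_from X x a -> distances_from X y a -> distances_from X z a ->
  distances_from X w a.
Proof.
move=> Xx Xy Xz Xw xy xz yz ax ay az; apply: contrapT => aw.
have step u : X u -> distances_from X u a ->
    u <> w /\ a <> edist u w.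
  move=> Xu au; have uw : u <> w by move=> e; apply: aw; rewrite -e.
  by split=> // e; apply: aw; rewrite e; exact: distances_from_r.
have same u v : X u -> X v -> distances_from X u a -> distances_from X v a ->
    edist u w = edist v w -> u = v.
  move=> Xu Xv au av e; have [uw ne] := step _ Xu au; have [vw _] := step _ Xv av.
  apply: inj => //; apply: card_le_I2_eq (X2 Xu) (X2 Xv) ne _ _ _ _ => //.
    exact: distances_from_l.
  by rewrite e; exact: distances_from_l.
have [xw _] := step _ Xx ax.
have [yw _] := step _ Xy ay.
have [zw _] := step _ Xz az.
have /card_le_I2P /(_ (edist x w) (edist y w) (edist z w)) := X2 Xw.
by case=> [|||/same|/same|/same]; try exact: distances_from_r; auto.
Qed.

(** The bound is attained by scalene triangles.  Among four points, two are at the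
same distance a from the first, so a is seen from three points, hence from
everywhere, which [no_common_distance] excludes. *)
Lemma injective_bound : X #<= `I_3.
Proof.
apply/card_le_IP => -[|x [|y [|z [|w s]]]] //= us sX; exfalso.
have [Xx Xy Xz Xw] : [/\ X x, X y, X z & X w].
  by split; apply: sX; rewrite /= !inE eqxx ?orbT.
move: us; rewrite !inE !negb_or -!andbA.
case/and5P => /eqP xy /eqP xz /eqP xw _.
case/and4P => /eqP yz /eqP yw _ /and3P[/eqP zw _ _].
have common u v : X u -> X v -> x <> u -> x <> v -> u <> v ->
    edist x u = edist x v -> False.
  move=> Xu Xv xu xv uv e; apply: (@no_common_distance (edist x u) x y) => // t Xt.
  apply: (@distance_spreads _ x u v) => //.
  - exact: distances_from_l.
  - exact: distances_from_r.
  - by rewrite e; exact: distances_from_r.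
have /card_le_I2P /(_ (edist x y) (edist x z) (edist x w)) := X2 Xx.
by case=> [|||/common|/common|/common]; try exact: distances_from_l; auto.
Qed.

End Classes.

Lemma proper_bound d (X : set 'rV[R]_d) : (2 <= d)%N ->
  proper_locally_two_distance X -> X #<= `I_(f R d).
Proof.
case: d X => [|[|n]] // X _ [X2 Xn2].
have f2 : (2 + LDS R n.+1 <= f R n.+2)%N by exact: leq_f1.
have [Xeq|Xneq] := pselect (forall p q, distances X p -> distances X q -> p = q).
  have [X1|] := pselect (forall x y, X x -> X y -> x = y).
    apply: card_le_trans (card_le_I1 X1) _; rewrite card_le_II.
    by apply: leq_trans f2; rewrite addSn.
  move=> /existsNP[x /existsNP[y /not_implyP[Xx /not_implyP[Xy xy]]]].
  apply: (@card_le_trans _ _ _ `I_(2 + LDS R n.+1)); last by rewrite card_le_II.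
  apply: (bisector_bound X2 Xx Xy xy) => z Xz zx zy.
  by apply: Xeq; [exists x, z|exists y, z]; split=> // /esym.
have D2 : ~ (distances X #<= `I_2).
  move=> D2; move: Xneq => /existsNP[p /existsNP[q]].
  move=> /not_implyP[Dp /not_implyP[Dq pq]].
  exact: Xn2 (card_eq_I2 D2 Dp Dq pq).
have [inj|] := pselect (forall x y, X x -> X y ->
    distances_from X x = distances_from X y -> x = y).
  apply: card_le_trans (injective_bound X2 inj) _; rewrite card_le_II.
  by apply: leq_trans f2; rewrite (leq_add2l 2 1) LDS_ge1.
move=> /existsNP[x /existsNP[y]].
move=> /not_implyP[Xx /not_implyP[Xy /not_implyP[Dxy xy]]].
pose Y := X `&` [set y | distances_from X y = distances_from X x].
pose Z := X `\` Y.
have [z1 [z2 [Zz1 Zz2 z12]]] : exists z1 z2, [/\ Z z1, Z z2 & z1 <> z2].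
  apply: contrapT => nZ; apply: D2; apply: card_le_trans (X2 _ Xx).
  apply: subset_card_le => _ [u [v [Xu Xv uv ->]]].
  have [[_ <-]|nYu] := pselect (Y u); first exact: distances_from_l.
  have [[_ <-]|nYv] := pselect (Y v); first exact: distances_from_r.
  by case: nZ; exists u, v.
have Yx : Y x by split.
have Yy : Y y by split.
have Y2 : distances Y #<= `I_2.
  apply: card_le_trans (X2 _ Xx); apply: subset_card_le.
  by move=> _ [u [v [[Xu <-] [Xv _] uv ->]]]; exact: distances_from_l.
have [||i [id HY HZ]] := split_bound Yx Yy xy Zz1 Zz2 z12 Y2.
- by apply: locally_two_distance_sub X2 => z [].
- move=> z u v [Xz nYz] [Xu Du] [Xv Dv].
  apply: (@distances_from_equidistant _ X X2 x) => // Dz; exact: nYz.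
have XYZ : X `<=` Y `|` Z.
  by move=> z Xz; have [Yz|nYz] := pselect (Y z); [left|right].
apply: card_le_trans (subset_card_le XYZ) _.
apply: card_le_trans (card_le_setU HY HZ) _.
by rewrite card_le_II leq_f.
Qed.

End Geometry.

Theorem theorem4p8 (R : realType) (d : nat) (hd : (2 <= d)%N) :
  (forall X : set 'rV[R]_d,
     proper_locally_two_distance X -> X #<= `I_(f R d)) /\
  (LDS R d <= maxn (DS R d) (f R d))%N.
Proof.
split=> [X|]; first exact: proper_bound.
have [[X X2 XL] _] := is_largest_LDS R d.
rewrite leq_max; apply/orP; have [X2'|X2'] := pselect (two_distance X).
  by left; have := DS_max X2'; rewrite (card_le_eql XL) card_le_II.
right; have : X #<= `I_(f R d) by apply: proper_bound.
by rewrite (card_le_eql XL) card_le_II.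
Qed.
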